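(* Let $n\in\mathbb{P}$, $n\ge 2$. Then \[\sum_{\sigma\in D_n}(-1)^{\ell(\sigma)}x^{L(\sigma)}=\prod_{j=2}^{n}\left(1+(-1)^{j-1}x^{\lfloor j/2\rfloor}\right)^2.\]
   Context: $\mathbb{P}=\{1,2,\dots\}$, $[n]=\{1,\dots,n\}$. $B_n$ is the group of bijections $\sigma$ of $\{-n,\dots,n\}$ with $\sigma(-j)=-\sigma(j)$, written in window notation $[\sigma(1),\dots,\sigma(n)]$; $D_n$ is the subgroup of those with an even number of negative entries among $\sigma(1),\dots,\sigma(n)$. For $\sigma\in D_n$: $\ell(\sigma)=\mathrm{inv}(\sigma)+\mathrm{nsp}(\sigma)$, where $\mathrm{inv}(\sigma)=|\{(i,j)\in[n]^2:i<j,\sigma(i)>\sigma(j)\}|$ and $\mathrm{nsp}(\sigma)=|\{(i,j)\in[n]^2:i<j,\sigma(i)+\sigma(j)<0\}|$; $L(\sigma)=\mathrm{oinv}(\sigma)+\mathrm{onsp}(\sigma)$, where $\mathrm{oinv}(\sigma)=|\{(i,j)\in[n]^2:i<j,\sigma(i)>\sigma(j),i\not\equiv j\pmod 2\}|$ and $\mathrm{onsp}(\sigma)=|\{(i,j)\in[n]^2:\sigma(i)+\sigma(j)<0,i\not\equiv j\pmod 2\}|$.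
   Formalization: In onsp each pair is counted once (i<j is required); with the ordered pairs (i,j) in [n]^2 of the stated definition the formula fails at n=2, where the sum is (1-x)(1-x^2) instead of (1-x)^2. *)

(* Defs.v *)
From HB Require Import structures.
From mathcomp Require Import all_boot all_order all_algebra fingroup perm.

Set Implicit Arguments.
Unset Strict Implicit.
Unset Printing Implicit Defensive.

Import Order.TTheory GRing.Theory Num.Theory.
Local Open Scope ring_scope.

(* The set {-n, ..., n}: the ordinal i encodes the integer i - n, so that
   negation is rev_ord. *)
Notation signed n := 'I_(n.*2.+1).

Definition sgnval (n : nat) (i : signed n) : int := (i : nat)%:Z - n%:Z.

Definition sgnopp (n : nat) (i : signed n) : signed n := rev_ord i.

Lemma sgnvalN (n : nat) (i : signed n) : sgnval (sgnopp i) = - sgnval i.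
Proof.
rewrite /sgnval /sgnopp /= subSS -subzn; last by rewrite -ltnS.
rewrite opprB; have -> : (n.*2)%:Z = n%:Z + n%:Z by rewrite -addnn PoszD.
by rewrite addrAC addrK.
Qed.

Definition hyperoct (n : nat) : {set {perm (signed n)}} :=
  [set s : {perm (signed n)} | [forall j, s (sgnopp j) == sgnopp (s j)]].

(* [n], as the positive part of {-n, ..., n}. *)
Definition posidx (n : nat) : {set signed n} := [set i | 0 < sgnval i].

Definition neg (n : nat) (s : {perm (signed n)}) : nat :=
  #|[set i in posidx n | sgnval (s i) < 0]|.

Definition even_hyperoct (n : nat) : {set {perm (signed n)}} :=
  [set s in hyperoct n | ~~ odd (neg s)].

(* The pairs (i, j) in [n]^2 with i < j. *)
Definition pospairs (n : nat) : {set signed n * signed n} :=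
  [set p in setX (posidx n) (posidx n) | sgnval p.1 < sgnval p.2].

Definition inv (n : nat) (s : {perm (signed n)}) : nat :=
  #|[set p in pospairs n | sgnval (s p.1) > sgnval (s p.2)]|.

Definition nsp (n : nat) (s : {perm (signed n)}) : nat :=
  #|[set p in pospairs n | sgnval (s p.1) + sgnval (s p.2) < 0]|.

Definition oinv (n : nat) (s : {perm (signed n)}) : nat :=
  #|[set p in pospairs n | (sgnval (s p.1) > sgnval (s p.2)) &&
       (sgnval p.1 != sgnval p.2 %[mod 2])%Z]|.

(* The pairs are counted once each, i.e. with i < j, as in nsp. Over ordered pairs
   (i, j) in [n]^2 without this condition, the product formula already fails
   for n = 2: the sum is (1 - x)(1 - x^2) instead of (1 - x)^2. *)
Definition onsp (n : nat) (s : {perm (signed n)}) : nat :=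
  #|[set p in pospairs n | (sgnval (s p.1) + sgnval (s p.2) < 0) &&
       (sgnval p.1 != sgnval p.2 %[mod 2])%Z]|.

Definition lenD (n : nat) (s : {perm (signed n)}) : nat := (inv s + nsp s)%N.

Definition oddlenD (n : nat) (s : {perm (signed n)}) : nat :=
  (oinv s + onsp s)%N.

(* Main.v *)
(** For a pair [i < j] of positions, [s i > s j] and [s i + s j < 0] are together
    counted once if [|s i| > |s j|], and otherwise twice or not at all according
    to the sign of [s j].  With [t = |s|], the sign [(-1)^lenD] is thus that of [t],
    and the signs of the entries contribute independently: summing over them turns
    the weight of [t] into a product over positions [j] (numbered from [0]) of
    [x^(m - c) + x^(m + c)], where [m] is the number of [i < j] of parity opposite
    to [j] and [c] the number of those with [t i < t j].  The restriction to even
    sign patterns only halves the sum, since [c = 0] at the position of the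
    smallest entry.

    The sum over [t] is computed by appending positions on the right.  Record the
    word of parities of the positions of the values [0, 1, ...].  A new position with
    value [v] inserts a letter at index [v], with sign [(-1)^(n - v)]; inserting it just
    before or just after an equal letter gives the same word and the same [c] with
    opposite signs.  Hence only alternating words survive, and for these
    the few uncancelled insertions give the factors of the product. *)

Require Import Defs.
From mathcomp Require Import all_boot all_order all_algebra fingroup perm.
From mathcomp Require Import zify ring.

Set Implicit Arguments.
Unset Strict Implicit.
Unset Printing Implicit Defensive.

Import Order.TTheory GRing.Theory Num.Theory.
Local Open Scope ring_scope.

(** * Statistics and weights of unsigned permutations *)

Definition pinv n (t : 'S_n) : nat :=
  (\sum_(j < n) \sum_(i < n) ((i < j) && (t j < t i)))%N.

Definition oasc n (t : 'S_n) (j : 'I_n) : nat :=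
  (\sum_(i < n) [&& i < j, odd i != odd j & t i < t j])%N.

(** The two terms come from a positive and a negative entry at one position. *)
Definition sign_factor (m c : nat) : {poly int} := 'X^(m - c) + 'X^(m + c).

(** For [n > 0], this is twice the sum over the even sign patterns put on [t]. *)
Definition pweight n (t : 'S_n) : {poly int} :=
  (-1) ^+ pinv t * \prod_(j < n) sign_factor (uphalf j) (oasc t j).

Definition colour n (t : 'S_n) : seq bool :=
  [seq odd (t^-1%g v : 'I_n) | v : 'I_n].

Definition insert_at (b : bool) (w : seq bool) (v : nat) :=
  take v w ++ b :: drop v w.

Definition position_term (n : nat) (phi : seq bool -> {poly int}) (w : seq bool)
    (v : nat) : {poly int} :=
  (-1) ^+ (n - v) * sign_factor (uphalf n) (count (fun b => b != odd n) (take v w))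
     * phi (insert_at (odd n) w v).

Definition add_position (n : nat) (phi : seq bool -> {poly int}) (w : seq bool) :=
  \sum_(v < n.+1) position_term n phi w v.

Lemma size_colour n (t : 'S_n) : size (colour t) = n.
Proof. by rewrite size_map size_enum_ord. Qed.

Lemma nth_colour n (t : 'S_n) (v : 'I_n) :
  nth false (colour t) v = odd (t^-1%g v : 'I_n).
Proof.
by rewrite (nth_map v) ?size_enum_ord // nth_ord_enum.
Qed.

(** * Appending a last position *)

Lemma lift_permE_lift n (v : 'I_n.+1) (t : 'S_n) (i : 'I_n) :
  lift_perm ord_max v t (widen_ord (leqnSn n) i) = lift v (t i).
Proof.
have -> : widen_ord (leqnSn n) i = lift ord_max i.
  by apply: val_inj; rewrite /= /bump leqNgt ltn_ord.
by rewrite lift_perm_lift.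
Qed.

Lemma ltn_lift n (v : 'I_n.+1) (a b : 'I_n) : (lift v a < lift v b)%N = (a < b)%N.
Proof. by rewrite /= /bump; lia. Qed.

Lemma lift_ltn n (v : 'I_n.+1) (a : 'I_n) : (lift v a < v)%N = (a < v)%N.
Proof. by rewrite /= /bump; lia. Qed.

Lemma ltn_liftr n (v : 'I_n.+1) (a : 'I_n) : (v < lift v a)%N = (v <= a)%N.
Proof. by rewrite /= /bump; lia. Qed.

(** The new last entry is inverted with the [n - v] earlier entries whose value under [t] is at
    least [v]. *)
Lemma pinv_lift n (v : 'I_n.+1) (t : 'S_n) :
  pinv (lift_perm ord_max v t) = (pinv t + (n - v))%N.
Proof.
rewrite /pinv big_ord_recr /=; congr (_ + _)%N.
  apply: eq_bigr => j _; rewrite big_ord_recr /=.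
  rewrite [X in (_ + X)%N](_ : _ = 0)%N ?addn0; last by rewrite ltnNge ltnW.
  by apply: eq_bigr => i _; rewrite !lift_permE_lift ltn_lift.
rewrite big_ord_recr /= ltnn addn0 lift_perm_id.
under eq_bigr => i _ do rewrite lift_permE_lift ltn_liftr ltn_ord /=.
(* Summing over values instead of positions turns the condition into [v <= i]. *)
rewrite (reindex_inj (@perm_inj _ t^-1%g)) /=.
under eq_bigr => i _ do rewrite permKV.
have vn : (v <= n)%N by rewrite -ltnS.
rewrite -(big_mkord xpredT (fun i => (v <= i)%N : nat)) (big_cat_nat _ vn) //=.
rewrite big_nat big1 ?add0n; last by move=> i; lia.
rewrite big_nat (eq_bigr (fun=> 1%N)); last by move=> i /andP[-> _].
by rewrite -big_nat sum_nat_const_nat muln1.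
Qed.

Lemma oasc_lift n (v : 'I_n.+1) (t : 'S_n) (j : 'I_n) :
  oasc (lift_perm ord_max v t) (widen_ord (leqnSn n) j) = oasc t j.
Proof.
rewrite /oasc big_ord_recr /= [X in (_ + X)%N](_ : _ = 0)%N ?addn0.
  by apply: eq_bigr => i _; rewrite !lift_permE_lift ltn_lift.
by rewrite ltnNge ltnW.
Qed.

Lemma count_take_sum (T : Type) (x0 : T) (a : pred T) (w : seq T) (v : nat) :
  (v <= size w)%N -> count a (take v w) = (\sum_(i < v) a (nth x0 w i))%N.
Proof.
move=> vw; rewrite -sum1_count big_mkcond (big_nth x0) size_takel // big_mkord.
by apply: eq_bigr => i _; rewrite nth_take //; case: (a _).
Qed.

(** Indexed by value, the earlier entries below [v] are the first [v] letters of the word. *)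
Lemma oasc_lift_max n (v : 'I_n.+1) (t : 'S_n) :
  oasc (lift_perm ord_max v t) ord_max
  = count (fun b => b != odd n) (take v (colour t)).
Proof.
rewrite /oasc big_ord_recr /= ltnn addn0 lift_perm_id.
under eq_bigr => i _ do rewrite lift_permE_lift lift_ltn ltn_ord /=.
rewrite (reindex_inj (@perm_inj _ t^-1%g)) /=.
under eq_bigr => i _ do rewrite permKV.
have vn : (v <= n)%N by rewrite -ltnS.
transitivity (\sum_(i < n) ((nth false (colour t) i != odd n) && (i < v)))%N.
  by apply: eq_bigr => i _; rewrite nth_colour.
rewrite -(big_mkord xpredT
  (fun i => (nth false (colour t) i != odd n) && (i < v)%N : nat)).
rewrite (big_cat_nat _ vn) //= [X in (_ + X)%N]big_nat [X in (_ + X)%N]big1 ?addn0;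
  last by move=> i; lia.
rewrite (count_take_sum false) ?size_colour // -[RHS](big_mkord xpredT
  (fun i => (nth false (colour t) i != odd n) : nat)).
by apply: eq_big_nat => i /andP[_ ->]; rewrite andbT.
Qed.

Lemma colour_lift n (v : 'I_n.+1) (t : 'S_n) :
  colour (lift_perm ord_max v t) = insert_at (odd n) (colour t) v.
Proof.
have vn : (v <= n)%N by rewrite -ltnS.
have sz : size (insert_at (odd n) (colour t) v) = n.+1.
  by rewrite size_cat /= size_takel ?size_drop ?size_colour //; lia.
apply: (@eq_from_nth _ false); rewrite ?size_colour ?sz // => u un.
rewrite (nth_colour _ (Ordinal un)) lift_permV nth_cat size_takel ?size_colour //.
case: (unliftP v (Ordinal un)) => [k|] Ek; last first.
  by rewrite Ek lift_perm_id -Ek /= ltnn subnn.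
rewrite Ek lift_perm_lift /= /bump [(n <= _)%N]leqNgt ltn_ord add0n.
have -> : u = lift v k :> nat by rewrite -Ek.
rewrite lift_ltn; case: ltnP => [kv|vk].
  by rewrite /= /bump leqNgt kv nth_take // nth_colour.
by rewrite /= /bump vk add1n subSn //= nth_drop subnKC // nth_colour.
Qed.

(** Both sides have [(n+1)!] elements, so injectivity suffices. *)
Lemma lift_perm_max_bij n :
  bijective (fun p : 'I_n.+1 * 'S_n => lift_perm ord_max p.1 p.2).
Proof.
apply: inj_card_bij => [[v t] [v' t'] /= E|]; last first.
  by rewrite card_prod !card_Sn card_ord.
have vv' : v = v'.
  by have /permP/(_ ord_max) := E; rewrite !lift_perm_id.
congr (_, _); rewrite -vv' in E => //; apply/permP => i.
by have /permP/(_ (lift ord_max i)) := E; rewrite !lift_perm_lift => /lift_inj.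
Qed.

Lemma pweight_lift n (v : 'I_n.+1) (t : 'S_n) :
  pweight (lift_perm ord_max v t) = pweight t * ((-1) ^+ (n - v)
     * sign_factor (uphalf n) (count (fun b => b != odd n) (take v (colour t)))).
Proof.
rewrite /pweight pinv_lift exprD big_ord_recr /= oasc_lift_max.
under eq_bigr => j _ do rewrite oasc_lift.
by ring.
Qed.

(* The test function [phi] of the colour word makes the sum over permutations
   with a given word available without isolating it. *)
Lemma sum_colour_recr n (phi : seq bool -> {poly int}) :
  \sum_(t : 'S_n.+1) pweight t * phi (colour t)
  = \sum_(t : 'S_n) pweight t * add_position n phi (colour t).
Proof.
rewrite (reindex _ (onW_bij _ (lift_perm_max_bij n))) /=.
rewrite -(pair_bigA _ (fun v t => pweight (lift_perm ord_max v t)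
   * phi (colour (lift_perm ord_max v t)))) /= exchange_big /=.
apply: eq_bigr => t _; rewrite /add_position big_distrr /=.
by apply: eq_bigr => v _; rewrite pweight_lift colour_lift /position_term !mulrA.
Qed.

(** * Alternating words and cancelling insertions *)

Definition altw (b : bool) (k : nat) : seq bool := mkseq (fun i => odd i (+) b) k.
Arguments altw : simpl never.

Lemma altwS b k : altw b k.+1 = b :: altw (~~ b) k.
Proof.
rewrite /altw /mkseq /= -[1%N]addn0 iotaDl -map_comp; congr (_ :: _).
by apply: eq_map => i /=; rewrite addNb addbN.
Qed.

Lemma altw_rcons b k : altw b k.+1 = rcons (altw b k) (odd k (+) b).
Proof. by rewrite /altw /mkseq -[k.+1]addn1 iotaD map_cat cats1. Qed.

Lemma count_altw b c k :
  count (fun a => a != c) (altw b k) = (if b == c then k./2 else uphalf k).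
Proof.
elim: k b => [|k IH] b; first by case: ifP.
by rewrite altwS /= IH; move: b c {IH} => [] [] //=; lia.
Qed.

Section AlternatingSums.
Variables (R : zmodType) (F : nat -> R) (k : nat).

(** Pairing from the left leaves the last of an odd number of terms. *)
Lemma sum_cancel_even :
  (forall i, (i < k)%N -> F i.*2 + F i.*2.+1 = 0) ->
  \sum_(v < k.*2.+1) F v = F k.*2.
Proof.
elim: k => [|m IH] H; first by rewrite big_ord1.
rewrite doubleS big_ord_recr big_ord_recr /= IH; last by move=> i im; apply/H/ltnW.
by rewrite H // add0r.
Qed.

(** Pairing from the right leaves the first term. *)
Lemma sum_cancel_odd :
  (forall i, (i < k)%N -> F i.*2.+1 + F i.*2.+2 = 0) ->
  \sum_(v < k.*2.+1) F v = F 0%N.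
Proof.
elim: k => [|m IH] H; first by rewrite big_ord1.
rewrite doubleS big_ord_recr big_ord_recr /= IH; last by move=> i im; apply/H/ltnW.
by rewrite -addrA H // addr0.
Qed.

End AlternatingSums.

(** Crossing a letter equal to the inserted one changes neither the word nor the count of opposite
    letters, while [n - v] drops by one. *)
Lemma position_term_cancel n phi w v :
  (v < n)%N -> size w = n -> nth false w v = odd n ->
  position_term n phi w v + position_term n phi w v.+1 = 0.
Proof.
move=> vn sw wv; rewrite /position_term.
have -> : insert_at (odd n) w v.+1 = insert_at (odd n) w v.
  rewrite /insert_at (take_nth false) ?sw // [drop v w](drop_nth false) ?sw // wv.
  by rewrite cat_rcons.
have -> : count (fun b => b != odd n) (take v.+1 w)
        = count (fun b => b != odd n) (take v w).
  by rewrite (take_nth false) ?sw // -cats1 count_cat /= wv eqxx !addn0.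
by rewrite -(subnSK vn) exprS mulN1r !mulNr addNr.
Qed.

Lemma position_term0 n phi w :
  position_term n phi w 0
  = (-1) ^+ n * (2%:R * 'X^(uphalf n)) * phi (odd n :: w).
Proof.
rewrite /position_term /insert_at subn0 take0 drop0 /sign_factor /= subn0 addn0.
by congr (_ * _ * _); ring.
Qed.

Lemma position_term_last n phi w : size w = n ->
  position_term n phi w n
  = sign_factor (uphalf n) (count (fun b => b != odd n) w) * phi (rcons w (odd n)).
Proof.
move=> sw; rewrite /position_term /insert_at take_oversize ?sw // drop_oversize ?sw //.
by rewrite subnn mul1r cats1.
Qed.

Lemma sign_factor_diag m : sign_factor m m = 1 + 'X^m ^+ 2.
Proof. by rewrite /sign_factor subnn expr0 addnn -mul2n mulnC exprM. Qed.

(** The letters [true] sit at odd indices, so the insertions at [2i+1] and [2i+2] cancel and those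
    at the two ends remain. *)
Lemma add_position_odd k phi :
  add_position k.*2.+1 phi (altw false k.*2.+1)
  = (1 + 'X^(k.+1) ^+ 2) * phi (altw false k.*2.+2)
    - 2%:R * 'X^(k.+1) * phi (altw true k.*2.+2).
Proof.
rewrite /add_position big_ord_recr /= sum_cancel_odd => [|i ik]; last first.
  apply: position_term_cancel; rewrite ?size_mkseq //; first lia.
  by rewrite nth_mkseq ?oddS ?odd_double //; lia.
rewrite position_term0 position_term_last ?size_mkseq //.
have -> : rcons (altw false k.*2.+1) (odd k.*2.+1) = altw false k.*2.+2.
  by rewrite [RHS]altw_rcons addbF.
rewrite count_altw /= odd_double /= doubleK sign_factor_diag.
have -> : true :: altw false k.*2.+1 = altw true k.*2.+2 by rewrite [RHS]altwS.
by rewrite exprS -signr_odd odd_double; ring.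
Qed.

(** The letters [false] sit at even indices, so only the insertion at the end remains. *)
Lemma add_position_even_false k phi :
  add_position k.*2.+2 phi (altw false k.*2.+2)
  = (1 + 'X^(k.+1) ^+ 2) * phi (altw false k.*2.+3).
Proof.
rewrite /add_position -doubleS sum_cancel_even => [|i ik]; last first.
  apply: position_term_cancel; rewrite ?size_mkseq //; first lia.
  by rewrite nth_mkseq ?oddS ?odd_double //; lia.
rewrite position_term_last ?size_mkseq //.
have -> : rcons (altw false k.*2.+2) (odd k.*2.+2) = altw false k.*2.+3.
  by rewrite [RHS]altw_rcons addbF.
by rewrite count_altw /= odd_double /= uphalf_double doubleK sign_factor_diag.
Qed.

(** The letters [false] sit at odd indices, so only the insertion at the front remains. *)
Lemma add_position_even_true k phi :
  add_position k.*2.+2 phi (altw true k.*2.+2)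
  = 2%:R * 'X^(k.+1) * phi (altw false k.*2.+3).
Proof.
rewrite /add_position -doubleS sum_cancel_odd => [|i ik]; last first.
  apply: position_term_cancel; rewrite ?size_mkseq //; first lia.
  by rewrite nth_mkseq ?oddS ?odd_double //; lia.
rewrite position_term0 /= odd_double /= ?uphalf_double ?doubleK [altw false _]altwS /=.
by rewrite !exprS -signr_odd odd_double; ring.
Qed.

(** * The sum over all permutations *)

Definition double_square_prod n : {poly int} :=
  2%:R * \prod_(2 <= j < n.+1) (1 + (-1) ^+ (j - 1) * 'X^(j %/ 2)) ^+ 2.

Lemma double_square_prodS n : double_square_prod n.+2
  = double_square_prod n.+1 * (1 + (-1) ^+ n.+1 * 'X^(n.+2 %/ 2)) ^+ 2.
Proof. by rewrite /double_square_prod big_nat_recr //= subn1 mulrA. Qed.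

(** At odd length a single word survives, so the induction appends two positions at a time. *)
Lemma sum_colour_odd k phi :
  \sum_(t : 'S_k.*2.+1) pweight t * phi (colour t)
  = double_square_prod k.*2.+1 * phi (altw false k.*2.+1).
Proof.
elim: k phi => [|k IH] phi.
  rewrite sum_colour_recr (eq_bigr (fun=> add_position 0 phi [::])); last first.
    move=> t _; rewrite /pweight /pinv !big_ord0 expr0 !mul1r.
    by congr (add_position _ _ _); apply: size0nil; rewrite size_colour.
  rewrite sumr_const card_Sn /add_position big_ord1 /position_term.
  rewrite /double_square_prod big_geq //.
  rewrite fact0 mulr1n /sign_factor /insert_at /= expr0 mul1r mulr1.
  by [].
rewrite !doubleS sum_colour_recr sum_colour_recr IH add_position_odd.
rewrite add_position_even_false add_position_even_true !double_square_prodS.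
have -> : (k.*2.+2 %/ 2 = k.+1)%N by lia.
have -> : (k.*2.+3 %/ 2 = k.+1)%N by lia.
rewrite -signr_odd -[(-1) ^+ k.*2.+2]signr_odd /= odd_double /=.
(* With [X = x^(k+1)], [(1 + X^2)^2 - (2X)^2 = (1 - X)^2 (1 + X)^2] gives the factors for [2k+2] and
   [2k+3]. *)
by ring.
Qed.

Lemma sum_pweight n : \sum_(t : 'S_n.+1) pweight t = double_square_prod n.+1.
Proof.
have E m : \sum_(t : 'S_m) pweight t = \sum_(t : 'S_m) pweight t * 1.
  by apply: eq_bigr => t _; rewrite mulr1.
rewrite E -[n]odd_double_half; case: (odd n); rewrite ?add0n ?add1n.
  (* For even size, one further position merges both words: [1 + X^2 - 2X = (1 - X)^2]. *)
  rewrite (sum_colour_recr _ (fun=> 1)) sum_colour_odd add_position_odd.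
  rewrite double_square_prodS.
  have -> : (n./2.*2.+2 %/ 2 = n./2.+1)%N by lia.
  by rewrite -signr_odd /= odd_double; ring.
by rewrite (sum_colour_odd _ (fun=> 1)) mulr1.
Qed.

(** * Signed permutations as permutations with sign patterns *)

(* [Some (i, false)] and [Some (i, true)] encode [i + 1] and [-(i + 1)]. *)
Definition encode n (o : option ('I_n * bool)) : signed n :=
  inord (if o is Some (i, b) then (if b then n - i.+1 else n + i.+1)%N else n).

Definition decode n (x : signed n) : option ('I_n * bool) :=
  if (x < n)%N then omap (pair^~ true) (insub (n - x.+1)%N)
  else if (n < x)%N then omap (pair^~ false) (insub (x - n.+1)%N) else None.

Lemma encode_val n (o : option ('I_n * bool)) : encode o
  = (if o is Some (i, b) then (if b then n - i.+1 else n + i.+1)%N else n) :> nat.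
Proof.
rewrite inordK //; case: o => [[i []]|]; last 1 first; try have := ltn_ord i; lia.
Qed.

Lemma encodeK n : cancel (@encode n) (@decode n).
Proof.
move=> o; rewrite /decode encode_val; case: o => [[i []]|]; last 1 first.
- by rewrite ltnn.
- have lti := ltn_ord i; rewrite ifT; last lia.
  by rewrite (_ : n - (n - i.+1).+1 = i)%N ?valK //; lia.
have lti := ltn_ord i; rewrite ifF ?ifT; [|lia..].
by rewrite (_ : n + i.+1 - n.+1 = i)%N ?valK //; lia.
Qed.

Lemma decodeK n : cancel (@decode n) (@encode n).
Proof.
move=> x; have ltx := ltn_ord x; apply: val_inj; rewrite /= encode_val /decode.
case: ltnP => [xn|nx].
  by rewrite insubT /=; [lia | move=> H; lia].
case: ltnP => [xn|xn]; last by apply/eqP; rewrite eqn_leq nx xn.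
by rewrite insubT /=; [lia | move=> H; lia].
Qed.

Definition signed_int n (i : 'I_n) (b : bool) : int :=
  if b then - (i.+1)%:Z else (i.+1)%:Z.

Lemma sgnval_encode n (i : 'I_n) b : sgnval (encode (Some (i, b))) = signed_int i b.
Proof.
rewrite /sgnval encode_val /signed_int; have := ltn_ord i; case: b; lia.
Qed.

Lemma sgnval_encode0 n : sgnval (@encode n None) = 0.
Proof. by rewrite /sgnval encode_val subrr. Qed.

Definition oflip n (o : option ('I_n * bool)) := omap (fun p => (p.1, ~~ p.2)) o.

Lemma sgnval_inj n : injective (@sgnval n).
Proof. by move=> x y /addIr [] /val_inj. Qed.

Lemma sgnopp_encode n (o : option ('I_n * bool)) :
  sgnopp (encode o) = encode (oflip o).
Proof.
apply: sgnval_inj; rewrite sgnvalN; case: o => [[i b]|] /=; last first.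
  by rewrite sgnval_encode0 oppr0.
by rewrite !sgnval_encode /signed_int; case: b; rewrite ?opprK.
Qed.

(** [e] marks the negative entries of the window; the xor makes the action commute with negation. *)
Definition signed_act n (t : 'S_n) (e : {ffun 'I_n -> bool})
  (o : option ('I_n * bool)) := omap (fun p => (t p.1, e p.1 (+) p.2)) o.

Lemma signed_act_inj n (t : 'S_n) e : injective (signed_act t e).
Proof.
move=> [[i b]|] [[j c]|] //= [/perm_inj -> ] /addbI -> //.
Qed.

Lemma signed_perm_inj n (t : 'S_n) (e : {ffun 'I_n -> bool}) :
  injective (fun x : signed n => encode (signed_act t e (decode x))).
Proof.
move=> x y /(can_inj (@encodeK n)) /signed_act_inj.
exact: (can_inj (@decodeK n)).
Qed.

Definition signed_perm n (te : 'S_n * {ffun 'I_n -> bool}) : {perm signed n} :=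
  perm (@signed_perm_inj n te.1 te.2).

Lemma signed_permE n (te : 'S_n * {ffun 'I_n -> bool}) o :
  signed_perm te (encode o) = encode (signed_act te.1 te.2 o).
Proof. by rewrite permE encodeK. Qed.

Lemma signed_perm_injective n : injective (@signed_perm n).
Proof.
move=> [t e] [t' e'] /permP E.
have {}E i : (t i, e i) = (t' i, e' i).
  have := E (encode (Some (i, false))).
  rewrite !signed_permE => /(can_inj (@encodeK n)) /=.
  by rewrite !addbF => -[-> ->].
congr (_, _); first by apply/permP => i; case: (E i).
by apply/ffunP => i; case: (E i).
Qed.

Lemma signed_perm_hyperoct n (te : 'S_n * {ffun 'I_n -> bool}) :
  signed_perm te \in hyperoct n.
Proof.
rewrite inE; apply/forallP => x; rewrite -(decodeK x) sgnopp_encode.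
rewrite !signed_permE sgnopp_encode; apply/eqP; congr encode.
by case: (decode x) => [[i b]|] //=; rewrite addbN.
Qed.

(** Zero is the only fixed point of negation, hence is fixed by [s]; the images of the positive
    points then determine [t] and [e]. *)
Lemma hyperoct_signed_perm n (s : {perm signed n}) :
  s \in hyperoct n -> exists te, s = signed_perm te.
Proof.
rewrite inE => /forallP Hs.
pose f o := decode (s (encode o)).
have f_inj : injective f.
  by move=> o o' /(can_inj (@decodeK n)) /perm_inj /(can_inj (@encodeK n)).
have f_flip o : f (oflip o) = oflip (f o).
  rewrite /f -sgnopp_encode (eqP (Hs _)); apply: (can_inj (@encodeK n)).
  by rewrite -sgnopp_encode !decodeK.
have f0 : f None = None.
  have := f_flip None; case: (f None) => [[i b]|] //= [].
  by case: b.
have fS i : exists p, f (Some (i, false)) == Some p.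
  case E : (f _) => [p|]; first by exists p.
  by have := f_inj (Some (i, false)) None; rewrite E f0 => /(_ erefl).
pose g i := xchoose (fS i).
have fg i : f (Some (i, false)) = Some (g i) by apply/eqP/(xchooseP (fS i)).
(* Equal absolute values would force [i = j] or [i = -j] as signed points. *)
have t_inj : injective (fun i => (g i).1).
  move=> i j gij; case: (eqVneq (g i).2 (g j).2) => gb.
    have : f (Some (i, false)) = f (Some (j, false)).
      by rewrite !fg [g i]surjective_pairing gij gb -surjective_pairing.
    by case/f_inj.
  have : f (Some (i, false)) = f (oflip (Some (j, false))).
    rewrite f_flip !fg /= [g i]surjective_pairing gij; congr (Some (_, _)).
    by move: gb; case: (g i).2; case: (g j).2.
  by case/f_inj.
exists (perm t_inj, [ffun i => (g i).2]); apply/permP => x.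
rewrite -(decodeK x) signed_permE; apply: (can_inj (@decodeK n)).
rewrite encodeK -/(f (decode x)); case: (decode x) => [[i b]|] //=.
rewrite permE ffunE; case: b; rewrite ?addbF ?addbT.
  by rewrite -[Some (i, true)]/(oflip (Some (i, false))) f_flip fg.
by rewrite fg -surjective_pairing.
Qed.

(** * Statistics of a signed permutation *)

Definition posord n (i : 'I_n) : signed n := encode (Some (i, false)).

Lemma posord_inj n : injective (@posord n).
Proof. by rewrite /posord => i j /(can_inj (@encodeK n)) []. Qed.

Lemma sgnval_posord n (i : 'I_n) : sgnval (posord i) = (i.+1)%:Z.
Proof. exact: sgnval_encode. Qed.

Lemma posidxE n : posidx n = [set posord i | i : 'I_n].
Proof.
apply/setP => x; rewrite inE; apply/idP/imsetP => [|[i _ ->]]; last first.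
  by rewrite sgnval_posord.
rewrite -(decodeK x); case: (decode x) => [[i []]|]; last 1 first.
- by rewrite sgnval_encode0.
- by rewrite sgnval_encode /signed_int; lia.
by exists i.
Qed.

Lemma card_posidx n (Q : pred (signed n)) :
  #|[set x in posidx n | Q x]| = (\sum_(i < n) Q (posord i))%N.
Proof.
rewrite -sum1dep_card posidxE big_imset_cond /=; last by move=> i j _ _ /posord_inj.
by rewrite big_mkcond; apply: eq_bigr => i _; case: (Q _).
Qed.

Lemma card_pospairs n (Q : pred (signed n * signed n)) :
  #|[set p in pospairs n | Q p]|
  = (\sum_(j < n) \sum_(i < n) ((i < j) && Q (posord i, posord j)))%N.
Proof.
(* The swap makes the larger position the outer index, as in [pinv]. *)
pose h (p : 'I_n * 'I_n) := (posord p.2, posord p.1).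
have h_inj : injective h by move=> [i j] [k l] [/posord_inj -> /posord_inj ->].
have -> : [set p in pospairs n | Q p]
  = h @: [set p : 'I_n * 'I_n | (p.2 < p.1)%N && Q (h p)].
  apply/setP => -[x y]; rewrite !inE /=; apply/idP/imsetP; last first.
    case=> -[j i]; rewrite inE /= => /andP[ij Qij] [-> ->].
    by rewrite !sgnval_posord Qij /=; lia.
  case/andP=> /andP[/andP[xp yp] xy] Qxy.
  have : x \in posidx n by rewrite inE.
  have : y \in posidx n by rewrite inE.
  rewrite posidxE => /imsetP[j _ yj] /imsetP[i _ xi]; subst x y.
  exists (j, i) => //; rewrite inE /= /h /= Qxy andbT.
  by move: xy; rewrite !sgnval_posord; lia.
rewrite card_imset // -sum1dep_card big_mkcond pair_bigA /=.
by apply: eq_bigr => p _; case: (_ && _).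
Qed.

Section Statistics.
Variables (n : nat) (t : 'S_n) (e : {ffun 'I_n -> bool}).
Let s := signed_perm (t, e).

Lemma sgnval_signed_perm i : sgnval (s (posord i)) = signed_int (t i) (e i).
Proof. by rewrite signed_permE sgnval_encode /= addbF. Qed.

Lemma neg_signed_perm : neg s = (\sum_(i < n) e i)%N.
Proof.
rewrite /neg card_posidx; apply: eq_bigr => i _.
by rewrite sgnval_signed_perm /signed_int; case: (e i).
Qed.

(** The entry of larger absolute value decides both comparisons; [o] is [true] for [lenD] and the
    parity condition for [oddlenD]. *)
Lemma pair_stat (i j : 'I_n) (o : bool) :
  (((i < j) && ((signed_int (t j) (e j) < signed_int (t i) (e i))%R && o))
   + ((i < j) && ((signed_int (t i) (e i) + signed_int (t j) (e j) < 0)%R && o))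
  = [&& i < j, o & t j < t i] + 2 * ([&& i < j, o & t i < t j] * e j))%N.
Proof.
case: ltnP => //= ij; case: o; rewrite ?andbF //= !andbT.
have : t i != t j :> nat.
  by apply: contraTneq ij => /val_inj /perm_inj ->; rewrite ltnn.
by rewrite /signed_int; case: (e i); case: (e j); lia.
Qed.

Lemma lenD_signed_perm : exists k, lenD s = (pinv t + 2 * k)%N.
Proof.
exists (\sum_(j < n) \sum_(i < n) ([&& i < j, true & t i < t j] * e j))%N.
rewrite /lenD /Defs.inv /nsp !card_pospairs /pinv big_distrr -!big_split /=.
apply: eq_bigr => j _; rewrite big_distrr -!big_split /=.
apply: eq_bigr => i _; rewrite !sgnval_signed_perm.
by have := pair_stat i j true; rewrite !andbT.
Qed.

Lemma sum_opposite_parity (j : 'I_n) :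
  (\sum_(i < n) ((i < j) && (odd i != odd j)) = uphalf j)%N.
Proof.
have jn : (j <= n)%N by apply: ltnW.
rewrite -(big_mkord xpredT (fun i => (i < j) && (odd i != odd j) : nat)%N).
rewrite (big_cat_nat _ jn) //= [X in (_ + X)%N]big_nat.
rewrite [X in (_ + X)%N]big1 ?addn0; last by move=> i; lia.
rewrite (@eq_big_nat _ _ _ _ _ _ (fun i => (odd i != odd j) : nat)); last first.
  by move=> i /andP[_ ->].
have gen k b : (\sum_(0 <= i < k) (odd i != b) = (if b then uphalf k else k./2))%N.
  elim: k => [|k IH]; first by rewrite big_geq //; case: b.
  by rewrite big_nat_recr //= IH; case: b {IH} => /=; lia.
by rewrite gen; case: ifP; lia.
Qed.

Lemma oasc_compl (j : 'I_n) :
  (\sum_(i < n) [&& i < j, odd i != odd j & t j < t i] + oasc t j = uphalf j)%N.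
Proof.
rewrite -sum_opposite_parity /oasc -big_split /=; apply: eq_bigr => i _.
case: ltnP => //= ij; have : t i != t j :> nat.
  by apply: contraTneq ij => /val_inj /perm_inj ->; rewrite ltnn.
by lia.
Qed.

Lemma oddlenD_signed_perm : oddlenD s
  = (\sum_(j < n) ((uphalf j - oasc t j) + 2 * (oasc t j * e j)))%N.
Proof.
rewrite /oddlenD /oinv /onsp !card_pospairs -big_split /=.
apply: eq_bigr => j _; rewrite -(oasc_compl j) addnK /oasc big_distrl big_distrr /=.
rewrite -!big_split /=; apply: eq_bigr => i _.
rewrite !sgnval_signed_perm !sgnval_posord -pair_stat.
(* Passing from positions numbered from 1 to positions numbered from 0 shifts both parities. *)
have -> // : (i.+1 != j.+1 %[mod 2])%Z = (odd i != odd j) by lia.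
Qed.

Lemma signed_perm_weight :
  (-1) ^+ lenD s * 'X^(oddlenD s) = (-1) ^+ pinv t *
   \prod_(j < n) 'X^((uphalf j - oasc t j) + 2 * (oasc t j * e j)) :> {poly int}.
Proof.
have [k ->] := lenD_signed_perm.
rewrite oddlenD_signed_perm exprD exprM sqrrN !expr1n mulr1; congr (_ * _).
by elim/big_rec2: _ => // j x y _ <-; rewrite exprD.
Qed.

End Statistics.

(** * Summing over even sign patterns *)

(** Twice the indicator of evenness is [1 + (-1)^(sum of e)], and each of the two resulting sums
    factors over the positions. *)
Lemma even_sign_sum n (R : comNzRingType) (G : 'I_n -> bool -> R) :
  (\sum_(e : {ffun 'I_n -> bool} | ~~ odd (\sum_j e j)) \prod_j G j (e j)) *+ 2
  = \prod_j (G j true + G j false) + \prod_j (G j false - G j true).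
Proof.
have -> : \prod_j (G j true + G j false) = \prod_j \sum_(b : bool) G j b.
  by apply: eq_bigr => j _; rewrite big_bool.
have -> : \prod_j (G j false - G j true) = \prod_j \sum_(b : bool) (-1) ^+ b * G j b.
  by apply: eq_bigr => j _; rewrite big_bool /= mulN1r mul1r addrC.
rewrite !bigA_distr_bigA -big_split big_mkcond -sumrMnl /=.
apply: eq_bigr => e _; rewrite big_split /= prodrXr.
rewrite -signr_odd; case: (odd _) => /=.
  by rewrite mul0rn mulN1r subrr.
by rewrite mul1r mulr2n.
Qed.

(** Hence the sign of the entry of least absolute value does not affect [oddlenD]. *)
Lemma oasc_first n (t : 'S_n.+1) : oasc t (t^-1%g ord0) = 0%N.
Proof. by apply: big1 => i _; rewrite permKV ltn0 !andbF. Qed.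

Lemma sum_signs n (t : 'S_n.+1) :
  (\sum_(e : {ffun 'I_n.+1 -> bool} | ~~ odd (\sum_j e j))
    (-1) ^+ lenD (signed_perm (t, e)) * 'X^(oddlenD (signed_perm (t, e)))) *+ 2
  = pweight t.
Proof.
under eq_bigr => e _ do rewrite signed_perm_weight.
rewrite -big_distrr -mulrnAr /= /pweight; congr (_ * _).
pose G (j : 'I_n.+1) (b : bool) : {poly int} :=
  'X^((uphalf j - oasc t j) + 2 * (oasc t j * b)).
rewrite (even_sign_sum G) [X in _ + X](bigD1 (t^-1%g ord0)) //=.
have -> : G (t^-1%g ord0) false - G (t^-1%g ord0) true = 0.
  by rewrite /G oasc_first subrr.
rewrite mul0r addr0.
apply: eq_bigr => j _; rewrite /G /sign_factor addrC muln0 muln1 addn0.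
(* [oasc_compl] bounds [oasc t j] by [uphalf j], so the truncated subtraction is exact. *)
by congr ('X^_ + 'X^_); have := oasc_compl t j; lia.
Qed.

Theorem theorem4p1 (n : nat) (hn : (2 <= n)%N) :
  \sum_(s in even_hyperoct n) (-1) ^+ lenD s * 'X^(oddlenD s)
  = \prod_(2 <= j < n.+1) (1 + (-1) ^+ (j - 1) * 'X^(j %/ 2)) ^+ 2
  :> {poly int}.
Proof.
case: n hn => // n _.
have two0 : 2%:R != 0 :> {poly int}.
  by rewrite -polyC_natr polyC_eq0.
(* Both sides are doubled, since [pweight] counts the even patterns twice. *)
apply: (mulfI two0); rewrite -/(double_square_prod n.+1) -sum_pweight.
have -> : even_hyperoct n.+1
  = @signed_perm n.+1 @:
      [set te : 'S_n.+1 * {ffun 'I_n.+1 -> bool} | ~~ odd (\sum_j te.2 j)].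
  apply/setP => s; rewrite inE; apply/andP/imsetP.
    case=> /hyperoct_signed_perm[[t e] ->]; rewrite neg_signed_perm => He.
    by exists (t, e) => //; rewrite inE.
  case=> -[t e]; rewrite inE /= => He ->.
  by rewrite signed_perm_hyperoct neg_signed_perm.
rewrite big_imset /=; last by move=> ? ? _ _ /signed_perm_injective.
under [RHS]eq_bigr => t _ do rewrite -sum_signs.
rewrite sumrMnl mulr_natl; congr (_ *+ 2).
by rewrite pair_big_dep /=; apply: eq_big => [[t e]|[t e] _] //; rewrite inE.
Qed.
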